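(* Let $\rho\ge1$ be a real number and $D\ge1$ an integer. Let $\beta\in\mathbb{R}^D$ be the identity vector $\beta_p=p$. For a vector $\alpha\in\mathbb{R}^D$ let $M$ be the $D\times D$ counting matrix associated with the $t$-Student kernel function $f(x)=1/(1+x^\rho)$ and $\alpha,\beta$, i.e. $M[\ell,p]=f(c+\alpha_\ell\beta_p)$ with $c+\alpha_\ell\beta_p\in[0,1]$ for all $\ell,p\in[D]$. Then there exists a vector $\alpha$ such that $M$ is invertible and $$\tau(M)\le(7e)^{2\rho D},$$ where $\tau(M)=\max_{0\ne b\in\mathbb{R}^D}\|M^{-1}b\|_\infty/\|b\|_\infty$.
   Context: The counting matrix of a function $f:[0,1]\to\mathbb{R}$, vectors $\alpha,\beta\in\mathbb{R}^D$ and a real number $c$ with $c+\alpha_\ell\beta_p\in[0,1]$ for all $\ell,p$ is the matrix $M[\ell,p]=f(c+\alpha_\ell\beta_p)$. *)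

(* Defs.v *)
From HB Require Import structures.
From mathcomp Require Import all_boot all_order all_algebra.
From mathcomp Require Import all_classical all_reals all_analysis.

Set Implicit Arguments.
Unset Strict Implicit.
Unset Printing Implicit Defensive.

Import Order.TTheory GRing.Theory Num.Theory.
Import numFieldNormedType.Exports.

Local Open Scope classical_set_scope.
Local Open Scope ring_scope.

Section Defs.
Variables (R : realType) (D : nat).

(* Functions on [0, 1] are total functions R -> R that are only evaluated under
   the side condition [counting_dom]. *)
Definition counting_dom (c : R) (alpha beta : 'rV[R]_D) : Prop :=
  forall l p : 'I_D, 0 <= c + alpha 0 l * beta 0 p <= 1.

Definition counting_mx (f : R -> R) (c : R) (alpha beta : 'rV[R]_D) :
    'M[R]_D :=
  \matrix_(l < D, p < D) f (c + alpha 0 l * beta 0 p).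

(* 'I_D starts at 0, hence the shift in beta_p = p for p = 1, ..., D. *)
Definition id_vec : 'rV[R]_D := \row_(p < D) p.+1%:R.

(* powR satisfies 0 `^ rho = 0 for rho != 0, as required at x = 0. *)
Definition student_kernel (rho x : R) : R := (1 + x `^ rho)^-1.

(* The norm on column vectors is the library's mx_norm, that is the l_oo norm.
   For 0 < D the supremum is attained, see [tau_max]. *)
Definition tau (M : 'M[R]_D) : R :=
  sup [set `|invmx M *m b| / `|b| | b in [set b : 'cV[R]_D | b != 0]].

Lemma tau_max (M : 'M[R]_D) : (0 < D)%N ->
  (exists2 b : 'cV[R]_D, b != 0 & `|invmx M *m b| / `|b| = tau M) /\
  (forall b : 'cV[R]_D, b != 0 -> `|invmx M *m b| / `|b| <= tau M).
Proof.
move=> D0; pose N := invmx M; pose S i : R := \sum_j `|N i j|.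
pose i1 : 'I_D := Ordinal D0.
pose i0 := [arg max_(i > i1) S i]%O.
have Si0 i : S i <= S i0.
  by rewrite /i0; case: arg_maxP => // j _ /(_ i); apply.
have S0 i : 0 <= S i by apply: sumr_ge0.
have normE (v : 'cV[R]_D) : `|v| = \big[Order.max/0]_ij `|v ij.1 ij.2|.
  by rewrite -mx_normrE.
have coord (v : 'cV[R]_D) j : `|v j 0| <= `|v|.
  rewrite normE.
  by apply: (le_bigmax _ (fun ij => `|v ij.1 ij.2|) (j, 0)).
have ub (b : 'cV[R]_D) : b != 0 -> `|N *m b| / `|b| <= S i0.
  move=> b0; rewrite ler_pdivrMr ?normr_gt0//.
  rewrite normE; apply/bigmax_leP; split.
    by rewrite mulr_ge0.
  move=> [i k] _ /=; rewrite mxE (le_trans (ler_norm_sum _ _ _))//.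
  rewrite (@le_trans _ _ (S i * `|b|))//; last by rewrite ler_wpM2r.
  rewrite mulr_suml; apply: ler_sum => j _.
  by rewrite normrM ler_wpM2l// (ord1 k).
pose b : 'cV[R]_D := \col_j (if 0 <= N i0 j then 1 else -1).
have b1 j : `|b j 0| = 1 by rewrite mxE; case: ifP; rewrite ?normrN normr1.
have b0 : b != 0.
  apply/eqP => b0; have := b1 i1; rewrite b0 mxE normr0 => /eqP.
  by rewrite eq_sym oner_eq0.
have nb : `|b| = 1.
  apply/le_anti/andP; split; last by rewrite -(b1 i1).
  rewrite normE; apply/bigmax_leP; split => //.
  by move=> [i k] _ /=; rewrite (ord1 k) b1.
have eb : `|N *m b| / `|b| = S i0.
  apply/le_anti/andP; split; first exact: ub.
  rewrite nb divr1 (le_trans _ (coord _ i0))// mxE.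
  rewrite (le_trans _ (ler_norm _))//; apply: ler_sum => j _.
  rewrite mxE; case: ifPn => [h|]; first by rewrite mulr1 ger0_norm.
  by rewrite -ltNge => h; rewrite mulrN1 ltr0_norm.
have tS : tau M = S i0.
  apply/le_anti/andP; split.
    apply: ge_sup; first by exists (S i0), b.
    by move=> _ [c /= c0 <-]; exact: ub.
  apply: ub_le_sup; last by exists b.
  by exists (S i0) => _ [c /= c0 <-]; exact: ub.
by rewrite tS; split; [exists b | exact: ub].
Qed.

End Defs.

Arguments id_vec {R} D.

(* Main.v *)
(* For c = 0 the kernel factors through (alpha_l p)^rho = a_l b_p, with
   a_l = alpha_l^rho and b_p = p^rho, so M[l,p] = 1 / (1 + a_l b_p) is a
   Cauchy-type matrix with an explicit inverse.  Take alpha_l = l / D^2: then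
   0 <= a_l b_p <= 1 and a_l = b_l / D^(2 rho), so each entry of the inverse is
   at most 4^D times two products \prod_(k != l) D^rho / |k^rho - l^rho|.  As
   |k^rho - l^rho| >= |k - l|^rho, such a product is at most the rho-th power of
   D^(D-1) / ((l-1)! (D-l)!) <= 2^D D^D / D! <= (2 e)^D.  Row sums are thus at
   most D 4^D (2 e)^(2 rho D) <= (32 e^2)^(rho D) <= (7 e)^(2 rho D). *)
Require Import Defs.
From HB Require Import structures.
From mathcomp Require Import all_boot all_order all_algebra.
From mathcomp Require Import all_classical all_reals all_analysis.
From mathcomp Require Import ring lra zify.
Import Order.TTheory GRing.Theory Num.Theory.
Import numFieldNormedType.Exports.
Local Open Scope ring_scope.

Set Implicit Arguments.
Unset Strict Implicit.
Unset Printing Implicit Defensive.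

(** * Explicit inverse of the Cauchy-type matrix 1 / (1 + a_l b_p) *)

Section CauchyInverse.
Variables (F : fieldType) (D : nat) (a b : 'I_D -> F).

Definition cauchy_inv : 'M[F]_D := \matrix_(p < D, l < D)
  (\prod_q (1 + a l * b q) *
   \prod_(j | j != l) ((1 + a j * b p) / (a j - a l)) *
   \prod_(q | q != p) (b p - b q)^-1).

Hypotheses (inj_a : injective a) (inj_b : injective b).
Hypothesis b_neq0 : forall p, b p != 0.
Hypothesis ab_neq0 : forall l p, 1 + a l * b p != 0.

(* Column l of the inverse is the partial fraction decomposition of the
   rational function P / \prod_q (1 + b q 'X) taking the value (k == l) at
   a k; its numerator is identified at the poles - (b p)^-1. *)
Lemma mulmx_cauchy_inv :
  (\matrix_(l < D, p < D) (1 + a l * b p)^-1) *m cauchy_inv = 1%:M.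
Proof.
apply/matrixP => k l; rewrite !mxE.
(* A rescaled Lagrange basis polynomial: it vanishes at every a_j with j != l and equals
   [\prod_q (1 + a l * b q)] at a_l. *)
pose P : {poly F} := (\prod_q (1 + a l * b q))%:P *
  \prod_(j | j != l) ((a j - a l)^-1%:P * ((a j)%:P - 'X)).
pose Q : {poly F} := \sum_p (cauchy_inv p l)%:P *
  \prod_(q | q != p) (1 + (b q)%:P * 'X).
have szprod (G : 'I_D -> {poly F}) i :
    (forall j, size (G j) <= 2)%N -> (size (\prod_(j | j != i) G j)%R <= D)%N.
  move=> sG; have D0 : (0 < D)%N by exact: leq_ltn_trans (ltn_ord i).
  have : (\sum_(j | j != i) size (G j) <= \sum_(j | j != i) 2)%N.
    by apply: leq_sum => j _.
  rewrite sum_nat_const cardC1 card_ord => s2.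
  have := size_prod_leq (fun j => j != i) G.
  rewrite cardC1 card_ord; lia.
have szC (c : F) (p : {poly F}) n : (size p <= n)%N -> (size (c%:P * p)%R <= n)%N.
  by move=> sp; rewrite mul_polyC (leq_trans (size_scale_leq _ _)).
have szP : (size P <= D)%N.
  apply/szC/szprod => j; apply: szC.
  by rewrite -opprB size_polyN size_XsubC.
have szQ : (size Q <= D)%N.
  apply: (leq_trans (size_sum _ _ _)); apply/bigmax_leqP => p _.
  apply/szC/szprod => q; rewrite (leq_trans (size_polyD _ _))// size_poly1.
  by rewrite geq_max/= szC ?size_polyX.
(* Both polynomials have degree below D, so agreement at the D distinct points -1/b_p suffices. At
   -1/b_p only the p-th summand of Q survives. *)
have PQ : P = Q.
  apply/eqP; rewrite -subr_eq0; apply/eqP.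
  apply: (@roots_geq_poly_eq0 _ _ [seq - (b p)^-1 | p : 'I_D]).
  - apply/allP => _ /mapP[p _ ->]; rewrite rootE hornerD hornerN subr_eq0.
    rewrite hornerM hornerC horner_prod horner_sum.
    rewrite [X in _ == X](bigD1 p)//= [X in _ == _ + X]big1 ?addr0; last first.
      move=> i ip; rewrite hornerM horner_prod (bigD1 p) 1?eq_sym//=.
      by rewrite !hornerE mulrN divff// subrr /= mulr0 mul0r.
    rewrite hornerM hornerC horner_prod mxE -!mulrA -big_split/=.
    apply/eqP; congr (_ * _).
    transitivity (\prod_(j | j != l) ((1 + a j * b p) / (a j - a l)) *
                  \prod_(j | j != l) (b p)^-1).
      rewrite -big_split/=; apply: eq_bigr => j _; rewrite !hornerE opprK.
      rewrite -mulrA mulrCA; congr (_ * _).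
      by rewrite mulrDl mul1r mulfK// addrC.
    (* The products over j != l and q != p both have D - 1 factors, so each 1/b_p cancels against
       the denominator of 1 - b_q/b_p = (b_p - b_q)/b_p. *)
    congr (_ * _); rewrite [LHS]prodr_const cardC1 -(cardC1 p) -prodr_const.
    apply: eq_bigr => q qp; rewrite !hornerE.
    have ? : b p - b q != 0 by rewrite subr_eq0 (inj_eq inj_b) eq_sym.
    by have ? := b_neq0 p; field; apply/andP.
  - by rewrite map_inj_uniq ?enum_uniq// => p q /oppr_inj/invr_inj/inj_b.
  - rewrite size_map size_enum_ord (leq_trans (size_polyD _ _))//.
    by rewrite size_polyN geq_max szP.
(* Clearing the denominators of row k turns row k times column l into Q(a_k) = P(a_k). *)
have c0 : \prod_q (1 + a k * b q) != 0 by apply/prodf_neq0 => q _.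
apply: (mulfI c0); transitivity Q.[a k].
  rewrite mulr_sumr horner_sum; apply: eq_bigr => p _.
  rewrite [in LHS]mxE hornerM hornerC horner_prod (bigD1 p)//=.
  rewrite mulrA mulrC; congr (_ * _); rewrite mulrAC divff// mul1r.
  by apply: eq_bigr => q _; rewrite !hornerE mulrC.
rewrite -PQ hornerM hornerC horner_prod; have [->|kl] := eqVneq k l.
  congr (_ * _); apply: big1 => j jl; rewrite !hornerE mulVf//.
  by rewrite subr_eq0 (inj_eq inj_a).
have -> : \prod_(j | j != l) ((a j - a l)^-1%:P * ((a j)%:P - 'X)).[a k] = 0.
  by rewrite (bigD1 k)//= hornerM !hornerE subrr /= mulr0 mul0r.
by rewrite !mulr0.
Qed.

End CauchyInverse.

(** The indices below l contribute the distances l, ..., 1, those above it 1, ..., D - 1 - l. The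
    form [maxn - minn] is |k - l| in truncated arithmetic. *)
Lemma prod_ord_dist (D : nat) (l : 'I_D) :
  (\prod_(k < D | k != l) (maxn k l - minn k l) = l`! * (D.-1 - l)`!)%N.
Proof.
rewrite -(big_mkord (fun k => k != l :> nat) (fun k => maxn k l - minn k l)%N).
rewrite (big_cat_nat _ (n := l)) //=; last exact: ltnW.
rewrite [X in (_ * X)%N]big_ltn_cond //= eqxx; congr (_ * _)%N.
  rewrite fact_prod big_add1/= big_nat_rev/= big_nat_cond [RHS]big_nat_cond.
  by apply: eq_big => i; lia.
rewrite fact_prod [RHS]big_add1/= -{1}(add0n l.+1) big_addn.
have -> : (D - l.+1 = D.-1 - l)%N by lia.
rewrite big_nat_cond [RHS]big_nat_cond.
by apply: eq_big => i; lia.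
Qed.

Lemma leq_bin_exp2 (n m : nat) : ('C(n, m) <= 2 ^ n)%N.
Proof.
elim: n m => [|n IH] [|m] //; first by rewrite bin0 expn_gt0.
by rewrite binS expnS mul2n -addnn leq_add.
Qed.

(** * Inequalities for factorials, the exponential and real powers *)

Section RealBounds.
Variable R : realType.
Implicit Types (x y rho : R).

(** Induction through (1 + 1/m)^m <= e, which follows from 1 + 1/m <= e^(1/m); the step from 0 to 1
    is separate to keep m positive. *)
Lemma exprnn_le_expR_fact (n : nat) :
  (n%:R : R) ^+ n <= expR 1 ^+ n * n`!%:R.
Proof.
elim: n => [|n IH]; first by rewrite !expr0 fact0 mulr1.
have e1 : (1 : R) <= expR 1 by rewrite (le_trans _ (expR_ge1Dx 1))// lerDl.
case: n IH => [_|n IH]; first by rewrite !expr1 mulr1.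
set m : R := n.+1%:R in IH *.
have m0 : 0 < m by rewrite ltr0n.
have step : n.+2%:R ^+ n.+1 <= expR 1 * m ^+ n.+1.
  have -> : n.+2%:R = (1 + m^-1) * m.
    by rewrite mulrDl mul1r mulVf ?gt_eqF// -natr1.
  rewrite exprMn ler_wpM2r ?exprn_ge0 ?(ltW m0)//.
  have -> : expR 1 = expR m^-1 ^+ n.+1.
    by rewrite -expRM_natl mulfV ?gt_eqF.
  by rewrite lerXn2r ?nnegrE ?expR_ge0 ?expR_ge1Dx// addr_ge0 ?invr_ge0 ?(ltW m0).
rewrite exprS factS natrM mulrCA ler_wpM2l ?ler0n// (le_trans step)//.
by rewrite [expR 1 ^+ n.+2]exprS -mulrA ler_wpM2l ?expR_ge0.
Qed.

Lemma prod_div_dist_le (D : nat) (l : 'I_D) :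
  \prod_(k < D | k != l) (D%:R / `|k.+1%:R - l.+1%:R| : R)
    <= (2 * expR 1) ^+ D.
Proof.
have -> : \prod_(k < D | k != l) (D%:R / `|k.+1%:R - l.+1%:R| : R) =
    D%:R ^+ D.-1 / (l`! * (D.-1 - l)`!)%:R.
  rewrite big_split/= prodr_const cardC1 card_ord -prod_ord_dist natr_prod.
  rewrite -prodfV; congr (_ * _); apply: eq_bigr => k _; congr (_^-1).
  case: (leqP k l) => kl; first rewrite distrC.
    by rewrite -natrB// ger0_norm// subSS.
  by rewrite -natrB ?ltnS ?(ltnW kl)// ger0_norm// subSS.
case: D l => [[]//|n] l /=.
have ln : (l <= n)%N by rewrite -ltnS.
rewrite ler_pdivrMr ?ltr0n ?muln_gt0 ?fact_gt0//.
(* With this factor the left side becomes C(n,l) (n+1)^(n+1), and on the right the factorials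
   combine to (n+1)!. *)
rewrite -(@ler_pM2l _ (n.+1%:R * 'C(n, l)%:R)); last first.
  by rewrite mulr_gt0 ?ltr0n ?bin_gt0.
have -> : n.+1%:R * 'C(n, l)%:R * n.+1%:R ^+ n =
    'C(n, l)%:R * n.+1%:R ^+ n.+1 :> R by rewrite exprS; ring.
have -> : n.+1%:R * 'C(n, l)%:R * ((2 * expR 1) ^+ n.+1 * (l`! * (n - l)`!)%:R)
   = 2 ^+ n.+1 * (expR 1 ^+ n.+1 * n.+1`!%:R) :> R.
  by rewrite factS -(bin_fact ln) !natrM exprMn; ring.
apply: ler_pM; rewrite ?ler0n ?exprn_ge0//; last exact: exprnn_le_expR_fact.
rewrite -natrX ler_nat (leq_trans (leq_bin_exp2 _ _))//.
by rewrite leq_exp2l.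
Qed.

Lemma powR_prod (I : finType) (P : pred I) (f : I -> R) rho :
  (forall i, 0 <= f i) ->
  (\prod_(i | P i) f i) `^ rho = \prod_(i | P i) f i `^ rho.
Proof.
move=> f0; suff [] : (\prod_(i | P i) f i) `^ rho = \prod_(i | P i) f i `^ rho /\
  0 <= \prod_(i | P i) f i by [].
apply: (big_rec2 (fun x y => x `^ rho = y /\ 0 <= x)).
  by rewrite powR1.
by move=> i x y _ [<- x0]; rewrite powRM// mulr_ge0.
Qed.

(** In z^rho = z * z^(rho - 1) the second factor is nondecreasing because rho >= 1. *)
Lemma powR_superadd x y rho : 1 <= rho -> 0 <= x -> 0 <= y ->
  x `^ rho + y `^ rho <= (x + y) `^ rho.
Proof.
move=> rho1 x0 y0; have rho0 : rho != 0 by rewrite gt_eqF// (lt_le_trans ltr01).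
have split z : 0 <= z -> z `^ rho = z * z `^ (rho - 1).
  move=> z0; have [->|zn0] := eqVneq z 0; first by rewrite powR0// mul0r.
  by rewrite -{2}(powRr1 z0) -powRD ?zn0 ?implybT// addrC subrK.
rewrite !split ?addr_ge0// mulrDl lerD// ler_wpM2l//.
  by rewrite ge0_ler_powR ?nnegrE ?subr_ge0 ?addr_ge0 ?lerDl.
by rewrite ge0_ler_powR ?nnegrE ?subr_ge0 ?addr_ge0 ?lerDr.
Qed.

(** For x <= y this is superadditivity applied to y - x and x. *)
Lemma powR_dist_le x y rho : 1 <= rho -> 0 <= x -> 0 <= y ->
  `|x - y| `^ rho <= `|x `^ rho - y `^ rho|.
Proof.
move=> rho1; wlog xy : x y / x <= y.
  move=> H x0 y0; case: (leP x y) => [|/ltW] xy; first exact: H.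
  by rewrite distrC (distrC (x `^ rho)); exact: H.
move=> x0 y0; rewrite distrC (distrC (x `^ rho)) ger0_norm ?subr_ge0//.
rewrite (le_trans _ (ler_norm _))// lerBrDr.
have xy0 : 0 <= y - x by rewrite subr_ge0.
by have := powR_superadd rho1 xy0 x0; rewrite subrK.
Qed.

End RealBounds.

Lemma powRV (R : realType) (x rho : R) : 0 <= x ->
  x^-1 `^ rho = (x `^ rho)^-1.
Proof. by move=> x0; rewrite -powR_inv1// -powRrM mulN1r powRN. Qed.

(** The supremum is attained at some b, and each coordinate of M^-1 b is a sum of D terms of size at
    most B |b|. *)
Lemma tau_le_entries (R : realType) (D : nat) (M : 'M[R]_D) (B : R) :
  (0 < D)%N -> (forall i j, `|invmx M i j| <= B) -> tau M <= D%:R * B.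
Proof.
move=> D0 leB; have [[b b0 <-] _] := tau_max M D0.
have normE (v : 'cV[R]_D) : `|v| = \big[Order.max/0]_ij `|v ij.1 ij.2|.
  by rewrite -mx_normrE.
have B0 : 0 <= B by exact: le_trans (leB (Ordinal D0) (Ordinal D0)).
rewrite ler_pdivrMr ?normr_gt0// normE; apply/bigmax_leP; split.
  by rewrite !mulr_ge0.
move=> [i k] _ /=; rewrite mxE (le_trans (ler_norm_sum _ _ _))//.
have -> : D%:R * B * `|b| = \sum_(j < D) B * `|b|.
  by rewrite sumr_const card_ord -mulrA mulr_natl.
apply: ler_sum => j _; rewrite normrM ler_pM// normE.
exact: (le_bigmax _ (fun ij => `|b ij.1 ij.2|) (j, k)).
Qed.

(** * The nodes p^rho and the products over their differences *)

Section StudentNodes.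
Variables (R : realType) (rho : R) (D : nat).
Hypothesis rho_ge1 : 1 <= rho.

Let b (p : 'I_D) : R := p.+1%:R `^ rho.
Let d : R := D%:R `^ rho.

Lemma powR_nodes_inj : injective b.
Proof.
move=> p q bpq; apply/ord_inj/succn_inj/eqP; rewrite -(eqr_nat R) -subr_eq0.
rewrite -normr_eq0; apply/eqP/(@powR_eq0_eq0 _ _ rho)/le_anti.
rewrite powR_ge0 andbT (le_trans (powR_dist_le rho_ge1 _ _))//.
by rewrite -/(b p) -/(b q) bpq subrr normr0.
Qed.

(** Each factor is at most (D / |k - l|)^rho by [powR_dist_le], which reduces the bound to the
    rho-th power of the one for integer nodes. *)
Lemma prod_powR_nodes_le (l : 'I_D) :
  \prod_(k < D | k != l) (d / `|b k - b l|) <= ((2 * expR 1) ^+ D) `^ rho.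
Proof.
have rho0 : 0 <= rho by rewrite (le_trans ler01).
apply: (@le_trans _ _
    ((\prod_(k < D | k != l) (D%:R / `|k.+1%:R - l.+1%:R|)) `^ rho)); last first.
  rewrite ge0_ler_powR ?nnegrE ?prod_div_dist_le ?exprn_ge0 ?mulr_ge0//.
  by apply: prodr_ge0.
rewrite powR_prod => [|k]; last by rewrite divr_ge0.
apply: ler_prod => k kl; rewrite divr_ge0 ?powR_ge0//=.
rewrite powRM ?invr_ge0// powRV// ler_wpM2l ?powR_ge0//.
have nodes_gt0 : 0 < `|b k - b l|.
  by rewrite normr_gt0 subr_eq0 (inj_eq powR_nodes_inj).
have dist_gt0 : 0 < `|k.+1%:R - l.+1%:R| `^ rho :> R.
  by rewrite powR_gt0// normr_gt0 subr_eq0 eqr_nat eqSS.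
by rewrite lef_pV2 ?posrE// powR_dist_le.
Qed.

End StudentNodes.

(** * Choice of alpha, invertibility and the bound on tau *)

Theorem theorem15 (R : realType) (rho : R) (D : nat)
    (rho_ge1 : 1 <= rho) (D_ge1 : (1 <= D)%N) :
  exists (alpha : 'rV[R]_D) (c : R),
    [/\ counting_dom c alpha (id_vec D),
        counting_mx (student_kernel rho) c alpha (id_vec D) \in unitmx
      & tau (counting_mx (student_kernel rho) c alpha (id_vec D))
          <= (7 * expR 1) `^ (2 * rho * D%:R)].
Proof.
have rho_ge0 : 0 <= rho by rewrite (le_trans ler01).
pose alpha : 'rV[R]_D := \row_l (l.+1%:R / D%:R ^+ 2); exists alpha, 0.
pose d : R := D%:R `^ rho.
pose b (p : 'I_D) : R := p.+1%:R `^ rho.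
pose a (l : 'I_D) : R := b l / d ^+ 2.
have d_gt0 : 0 < d by rewrite powR_gt0// ltr0n.
have b_gt0 p : 0 < b p by rewrite powR_gt0// ltr0n.
have ab_ge0 l p : 0 <= a l * b p.
  by rewrite !mulr_ge0 ?invr_ge0 ?exprn_ge0 ?ltW.
have ab_le1 l p : a l * b p <= 1.
  rewrite mulrAC ler_pdivrMr ?exprn_gt0// mul1r expr2.
  by rewrite ler_pM ?(ltW (b_gt0 _))// ge0_ler_powR ?nnegrE ?ler0n ?ler_nat.
have inj_b : injective b by exact: powR_nodes_inj.
have inj_a : injective a.
  move=> j l /mulIf jl; apply/inj_b/jl.
  by rewrite invr_neq0// expf_neq0// gt_eqF.
have abN0 l p : 1 + a l * b p != 0 by rewrite gt_eqF// ltr_wpDr.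
have domain : counting_dom 0 alpha (id_vec D).
  move=> l p; rewrite !mxE add0r mulrAC; apply/andP; split.
    by rewrite divr_ge0 ?mulr_ge0 ?exprn_ge0.
  rewrite ler_pdivrMr ?exprn_gt0 ?ltr0n// mul1r expr2.
  by rewrite ler_pM ?ler_nat.
set M := counting_mx _ _ _ _.
have ME : M = \matrix_(l < D, p < D) (1 + a l * b p)^-1.
  apply/matrixP => l p; rewrite !mxE add0r /student_kernel; congr (_ + _)^-1.
  rewrite powRM ?divr_ge0 ?exprn_ge0// powRM ?invr_ge0 ?exprn_ge0//.
  by rewrite powRV ?exprn_ge0// expr2 powRM// -expr2.
have MN : M *m cauchy_inv a b = 1%:M.
  by rewrite ME mulmx_cauchy_inv// => p; rewrite gt_eqF.
have [Munit _] := mulmx1_unit MN.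
have invM : invmx M = cauchy_inv a b by rewrite -[RHS](mulKmx Munit) MN mulmx1.
split => //.
pose W : R := ((2 * expR 1) ^+ D) `^ rho.
(* Every factor 1 + a_i b_j lies in [1, 2], and at most D of them occur. *)
have prod_le2 (P : pred 'I_D) (G : 'I_D -> R) :
    (forall i, 0 <= G i <= 1) -> \prod_(i | P i) (1 + G i) <= 2 ^+ D.
  move=> G01; apply: (@le_trans _ _ (\prod_(i | P i) 2)).
    by apply: ler_prod => i _; have := G01 i; lra.
  rewrite prodr_const ler_weXn2l ?ler1n//.
  by rewrite -[leqRHS]card_ord max_card.
have entry p l : `|cauchy_inv a b p l| <= 2 ^+ D * (2 ^+ D * (W * W)).
  (* Since 1 / |a_j - a_l| = d^2 / |b_j - b_l|, each factor has a spare d; there are D - 1 of them,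
     exactly as many as the factors over q != p need. *)
  have -> : `|cauchy_inv a b p l| = \prod_q (1 + a l * b q) *
      (\prod_(j | j != l) (1 + a j * b p) *
       (\prod_(j | j != l) (d / `|b j - b l|) *
        \prod_(q | q != p) (d / `|b q - b p|))).
    rewrite mxE !normrM -!mulrA; congr (_ * _).
      by rewrite ger0_norm// prodr_ge0// => q _; rewrite addr_ge0.
    rewrite !normr_prod.
    have -> : \prod_(q | q != p) `|(b p - b q)^-1| =
        \prod_(j | j != l) d^-1 * \prod_(q | q != p) (d / `|b q - b p|).
      rewrite prodr_const cardC1 -(cardC1 p) -prodr_const -big_split/=.
      apply: eq_bigr => q _.
      by rewrite mulKf ?gt_eqF// normfV distrC.
    rewrite !mulrA -!big_split/=; congr (_ * _); apply: eq_bigr => j jl.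
    rewrite normrM normfV ger0_norm ?addr_ge0// -mulrBl.
    rewrite normrM normfV (ger0_norm (exprn_ge0 _ (ltW d_gt0))).
    have ? : `|b j - b l| != 0 by rewrite normr_eq0 subr_eq0 (inj_eq inj_b).
    have ? : d != 0 by rewrite gt_eqF.
    by field; apply/andP.
  have prod_ge0 (P : pred 'I_D) r : 0 <= \prod_(j | P j) (d / `|b j - b r|).
    by apply: prodr_ge0 => j _; rewrite divr_ge0// ltW.
  have prod1_ge0 (P : pred 'I_D) (G : 'I_D -> R) :
      (forall i, 0 <= G i <= 1) -> 0 <= \prod_(i | P i) (1 + G i).
    by move=> G01; apply: prodr_ge0 => i _; have := G01 i; lra.
  have ab01 i j : 0 <= a i * b j <= 1 by rewrite ab_ge0 ab_le1.
  rewrite !ler_pM ?mulr_ge0 ?prod_le2 ?prod1_ge0 ?prod_ge0//;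
    exact: prod_powR_nodes_le.
apply: (le_trans (tau_le_entries D_ge1 _)).
  by rewrite invM; exact: entry.
have eg0 : 0 <= expR 1 :> R by exact: expR_ge0.
have -> : (7 * expR 1) `^ (2 * rho * D%:R) =
    (((7 * expR 1) ^+ 2) ^+ D) `^ rho :> R.
  rewrite mulrAC powRrM -natrM powR_mulrn ?mulr_ge0//.
  by rewrite exprM.
have -> : D%:R * (2 ^+ D * (2 ^+ D * (W * W))) =
    D%:R * 4 ^+ D * (((2 * expR 1) ^+ 2) ^+ D) `^ rho :> R.
  rewrite /W -powRM ?exprn_ge0 ?mulr_ge0// -!exprMn -expr2.
  rewrite (_ : 4 = 2 * 2 :> R) ?exprMn; last by rewrite -natrM.
  by rewrite !mulrA.
(* D <= 2^D gives D 4^D <= 8^D, and 8^D <= (8^D)^rho because rho >= 1. *)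
apply: (@le_trans _ _ ((8 ^+ D) `^ rho * (((2 * expR 1) ^+ 2) ^+ D) `^ rho)).
  rewrite ler_wpM2r ?powR_ge0//; apply: (@le_trans _ _ (8 ^+ D)).
    rewrite (_ : 8 = 2 * 4 :> R); last by rewrite -natrM.
    by rewrite exprMn ler_wpM2r ?exprn_ge0// -natrX ler_nat ltnW// ltn_expl.
  by rewrite -[leLHS]powRr1 ?exprn_ge0// ler_powR// exprn_ege1// ler1n.
rewrite -powRM ?exprn_ge0 ?mulr_ge0// -exprMn.
rewrite ge0_ler_powR ?nnegrE ?exprn_ge0 ?mulr_ge0//.
rewrite lerXn2r ?nnegrE ?mulr_ge0 ?exprn_ge0 ?mulr_ge0//.
(* Once e^2 is cancelled, what remains is 8 * 2^2 = 32 <= 49 = 7^2. *)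
rewrite !exprMn mulrA ler_wpM2r ?exprn_ge0//.
by rewrite -!natrX -natrM ler_nat.
Qed.
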